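(* Let $G$ be a locally path connected, path connected, semilocally simply connected topological group with identity $1_G$, and let $H=\{[\gamma]\in\Pi_1(G):\gamma(0)=1_G\}$ be its universal covering group, with multiplication $[\gamma]\otimes[\eta]=[t\mapsto\gamma(t)\eta(t)]$, topology as a subspace of $\Pi_1(G)$, and covering homomorphism $p\colon H\to G$, $p([\gamma])=\gamma(1)$. Let $H\ltimes_p G$ be the transformation groupoid of the left action $[\eta]\cdot g=p([\eta])g$ of $H$ on $G$. Then the map $J\colon H\ltimes_p G\to\Pi_1(G)$, $J([\gamma],g)=[\gamma\cdot g]$ with $(\gamma\cdot g)(t)=\gamma(t)g$, is an isomorphism of topological groupoids. In particular $\Pi_1(G)$ is isomorphic to a transformation groupoid.
   Context: $\Pi_1(G)$ is the fundamental groupoid: endpoint-fixing path-homotopy classes $[\gamma]$ of paths in $G$, with range $\gamma(1)$, source $\gamma(0)$, product $[\alpha][\beta]=[\alpha\,\Box\,\beta]$ when $\alpha(0)=\beta(1)$ (where $\alpha\,\Box\,\beta$ first traverses $\beta$ then $\alpha$), and inverse given by the reversed path; it carries the UC topology, generated by the sets $N([\gamma],U,V)=\{[\delta\,\Box\,\gamma\,\Box\,\theta] : \delta\text{ a path in }U,\ \delta(0)=\gamma(1),\ \theta\text{ a path in }V,\ \theta(1)=\gamma(0)\}$ with $U,V$ path connected relatively inessential open neighbourhoods (a set $V$ is relatively inessential if $\pi_1(V,x)\to\pi_1(G,x)$ induced by inclusion is trivial). The transformation groupoid $H\ltimes_p G$ has underlying space $H\times G$ (product topology), source $(\eta,g)\mapsto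 g$, range $(\eta,g)\mapsto p(\eta)g$; $(\eta,h)$ and $(\gamma,g)$ are composable iff $h=p(\gamma)g$, with $(\eta,h)(\gamma,g)=(\eta\otimes\gamma,g)$, and $(\gamma,g)^{-1}=(\gamma^{-1},p(\gamma)g)$. *)

(* Defs.v *)
From HB Require Import structures.
From mathcomp Require Import all_boot all_order all_algebra.
From mathcomp Require Import all_classical all_reals all_analysis.
Import Order.TTheory GRing.Theory Num.Theory.
Import numFieldNormedType.Exports.

Set Implicit Arguments.
Unset Strict Implicit.
Unset Printing Implicit Defensive.

Local Open Scope classical_set_scope.
Local Open Scope ring_scope.

Record topGroup (G : topologicalType) := TopGroup {
  tg_mul : G -> G -> G;
  tg_inv : G -> G;
  tg_one : G;
  tg_mulA : forall x y z, tg_mul x (tg_mul y z) = tg_mul (tg_mul x y) z;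
  tg_mul1g : forall x, tg_mul tg_one x = x;
  tg_mulg1 : forall x, tg_mul x tg_one = x;
  tg_mulVg : forall x, tg_mul (tg_inv x) x = tg_one;
  tg_mulgV : forall x, tg_mul x (tg_inv x) = tg_one;
  tg_mul_cont : continuous (fun xy : G * G => tg_mul xy.1 xy.2);
  tg_inv_cont : continuous tg_inv }.

Section Paths.
Variables (R : realType) (G : topologicalType).

Definition unitI : set R := [set t | 0 <= t <= 1].

(** a path is a map continuous on [0,1] (values outside [0,1] are irrelevant) *)
Definition is_path (a : R -> G) := {within unitI, continuous a}.

Definition path_in (A : set G) (a : R -> G) := forall t, unitI t -> A (a t).

Definition path_homotopic (a b : R -> G) :=
  exists F : R * R -> G,
    {within unitI `*` unitI, continuous F} /\
    (forall t, unitI t -> F (0, t) = a t /\ F (1, t) = b t) /\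
    (forall s, unitI s -> F (s, 0) = a 0 /\ F (s, 1) = a 1).

Definition concat (a b : R -> G) : R -> G :=
  fun t => if t <= 2^-1 then b (2 * t) else a (2 * t - 1).

Definition reverse_path (a : R -> G) : R -> G := fun t => a (1 - t).

Definition path_connected_set (A : set G) :=
  forall x y, A x -> A y ->
    exists a, [/\ is_path a, path_in A a, a 0 = x & a 1 = y].

Definition locally_path_connected :=
  forall (x : G) (U : set G), nbhs x U ->
    exists V : set G, [/\ open V, V x, V `<=` U & path_connected_set V].

(** [gpd_1(V,x) -> gpd_1(G,x)] is trivial for every x in V *)
Definition rel_inessential (V : set G) :=
  forall x, V x -> forall a, is_path a -> path_in V a -> a 0 = x -> a 1 = x ->
    path_homotopic a (cst x).

Definition semilocally_simply_connected :=
  forall x : G, exists U : set G, [/\ open U, U x &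
    forall a, is_path a -> path_in U a -> a 0 = x -> a 1 = x ->
      path_homotopic a (cst x)].

Definition pclass (a : R -> G) : set (R -> G) :=
  [set b | is_path b /\ path_homotopic b a].

Definition Pi1set (C : set (R -> G)) := exists2 a, is_path a & C = pclass a.

End Paths.

Definition Pi1 (R : realType) (G : topologicalType) :=
  {C : set (R -> G) | Pi1set C}.

HB.instance Definition _ (R : realType) (G : topologicalType) :=
  gen_eqMixin (Pi1 R G).
HB.instance Definition _ (R : realType) (G : topologicalType) :=
  gen_choiceMixin (Pi1 R G).

Section Pi1ops.
Variables (R : realType) (G : topologicalType).

Definition rep (c : Pi1 R G) : R -> G := projT1 (cid2 (proj2_sig c)).

Definition mkPi1 (a : R -> G) (pa : is_path a) : Pi1 R G :=
  exist _ (pclass a) (ex_intro2 _ _ a pa erefl).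

Lemma cst_is_path (x : G) : is_path (cst x : R -> G).
Proof. by apply: continuous_subspaceT; exact: cst_continuous. Qed.

(** [cls a] = [a], the class of a path [a]; (junk value for non-paths) *)
Definition cls (a : R -> G) : Pi1 R G :=
  match pselect (is_path a) with
  | left pa => mkPi1 pa
  | right _ => mkPi1 (@cst_is_path (a 0))
  end.

Definition gpd_src (c : Pi1 R G) : G := rep c 0.
Definition gpd_rng (c : Pi1 R G) : G := rep c 1.
Definition gpd_composable (c d : Pi1 R G) := gpd_src c = gpd_rng d.
Definition gpd_mul (c d : Pi1 R G) : Pi1 R G := cls (concat (rep c) (rep d)).
Definition gpd_inv (c : Pi1 R G) : Pi1 R G := cls (reverse_path (rep c)).

Definition Nset (g : R -> G) (U V : set G) : set (Pi1 R G) :=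
  [set c | exists d th : R -> G,
     [/\ [/\ is_path d, path_in U d & d 0 = g 1],
         [/\ is_path th, path_in V th & th 1 = g 0] &
         proj1_sig c = pclass (concat d (concat g th))]].

Definition uc_subbase : set (set (Pi1 R G)) :=
  [set N | exists (g : R -> G) (U V : set G),
     [/\ is_path g,
         [/\ open U, U (g 1), path_connected_set R U & rel_inessential R U],
         [/\ open V, V (g 0), path_connected_set R V & rel_inessential R V] &
         N = Nset g U V]].

End Pi1ops.

HB.instance Definition _ (R : realType) (G : topologicalType) :=
  @isSubBaseTopological.Build (Pi1 R G) (set (Pi1 R G)) (@uc_subbase R G) id.

Section Cover.
Variables (R : realType) (G : topologicalType) (TG : topGroup G).

Local Notation "x * y" := (tg_mul TG x y).

Definition Hset : set (Pi1 R G) := [set c | rep c 0 = tg_one TG].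

(** H carries the subspace topology of Pi_1(G) (initial topology of set_val) *)
Definition Htype := set_type Hset.

Definition p_cov (h : Htype) : G := rep (set_val h) 1.

(** multiplication [g] (x) [e] = [t |-> g(t) e(t)] and inverse in H
   (the fallback branch is never taken; it only makes the functions total) *)
Definition H_mul (h k : Htype) : Htype :=
  let c := cls (fun t : R => rep (set_val h) t * rep (set_val k) t) in
  match pselect (Hset c) with
  | left pc => SigSub (mem_set pc)
  | right _ => h
  end.

Definition H_inv (h : Htype) : Htype :=
  let c := cls (fun t : R => tg_inv TG (rep (set_val h) t)) in
  match pselect (Hset c) with
  | left pc => SigSub (mem_set pc)
  | right _ => h
  end.

Definition tg_src (x : Htype * G) : G := x.2.
Definition tg_rng (x : Htype * G) : G := p_cov x.1 * x.2.
Definition tg_composable (x y : Htype * G) := x.2 = p_cov y.1 * y.2.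
Definition tg_gmul (x y : Htype * G) : Htype * G := (H_mul x.1 y.1, y.2).
Definition tg_ginv (x : Htype * G) : Htype * G :=
  (H_inv x.1, p_cov x.1 * x.2).

Definition Jmap (x : Htype * G) : Pi1 R G :=
  cls (fun t : R => rep (set_val x.1) t * x.2).

End Cover.

(* Main.v *)
Require Import Defs.
From HB Require Import structures.
From mathcomp Require Import all_boot all_order all_algebra.
From mathcomp Require Import all_classical all_reals all_analysis.
From mathcomp Require Import finmap lra.
Import Order.TTheory GRing.Theory Num.Theory.
Import numFieldNormedType.Exports.

Set Implicit Arguments.
Unset Strict Implicit.
Unset Printing Implicit Defensive.

Local Open Scope classical_set_scope.
Local Open Scope ring_scope.

(** Pointwise multiplication of paths respects homotopy, and concatenation is a
    product of reparametrisations: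
    [a □ b = (a \o hi) * a(0)^-1 * (b \o lo)], hence
    [a □ b ~ a * a(0)^-1 * b].  So the groupoid operations of Pi_1(G) are, on
    classes, pointwise operations of the group G, and the algebraic half of the
    theorem becomes a computation in G.

    For the topology, [J] and its inverse [c |-> ([c * c(0)^-1], c(0))] are both
    obtained from the right translation [(c, g) |-> [c * g]] from Pi_1(G) x G to
    Pi_1(G), which is jointly continuous for the UC topology, and from the
    continuous source map. *)

(** * Continuity on retracts, and the retraction of the line onto the unit interval *)

Lemma within_retract_continuous (T S : topologicalType) (A : set T)
    (r : T -> T) (f : T -> S) :
  continuous r -> (forall x, A (r x)) -> (forall x, A x -> r x = x) ->
  {within A, continuous f} <-> continuous (f \o r).
Proof.
move=> rc rA rid; split=> [/subspace_continuousP fc x|fc].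
  apply: cvg_trans (fc (r x) (rA x)) => U /=.
  rewrite !nbhs_simpl /= => /rc; rewrite nbhs_simpl /=.
  by apply: filterS => y /(_ (rA y)).
apply: (@subspace_eq_continuous _ _ _ (f \o r)).
  by move=> x /set_mem Ax /=; rewrite rid.
exact: continuous_subspaceT.
Qed.

Lemma pair_continuous (T U V : topologicalType) (f : T -> U) (g : T -> V) :
  continuous f -> continuous g -> continuous (fun x => (f x, g x)).
Proof.
move=> fc gc x; have fg := cvg_pair (fc x) (gc x); exact: fg.
Qed.

Section Clamp.
Variable R : realType.
Local Notation I := (@unitI R).

(** Retraction of the line onto [0,1]. Composing with it trades continuity on [0,1] for continuity
    on the whole line, where composites and products of continuous maps are directly available. *)
Definition clamp (t : R) : R := Num.min 1 (Num.max 0 t).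

Lemma clamp_unitI t : I (clamp t).
Proof.
rewrite /unitI /= /clamp; apply/andP; split.
  by rewrite le_min ler01 le_max lexx.
by rewrite ge_min lexx.
Qed.

Lemma clamp_id t : I t -> clamp t = t.
Proof. by move=> /andP[t0 t1]; rewrite /clamp (max_idPr t0) (min_idPr t1). Qed.

Lemma clamp_le0 t : t <= 0 -> clamp t = 0.
Proof. by move=> t0; rewrite /clamp (max_idPl t0); apply/min_idPr/ler01. Qed.

Lemma clamp_ge1 t : 1 <= t -> clamp t = 1.
Proof.
move=> t1; rewrite /clamp (max_idPr (le_trans ler01 t1)); exact/min_idPl.
Qed.

Lemma clamp_continuous : continuous clamp.
Proof.
move=> t; pose f : R -> R^o := cst 1 \min (cst 0 \max id).
have: {for t, continuous f}.
  apply: continuous_min; first exact: cvg_cst.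
  by apply: continuous_max; [exact: cvg_cst|exact: cvg_id].
exact.
Qed.

Lemma unitI0 : I 0. Proof. by rewrite /unitI /= lexx ler01. Qed.
Lemma unitI1 : I 1. Proof. by rewrite /unitI /= lexx ler01. Qed.

End Clamp.

#[local] Hint Resolve unitI0 unitI1 clamp_unitI : core.

(** * Paths and homotopies through globally continuous maps *)

Section PathsAndHomotopies.
Variables (R : realType) (G : topologicalType).
Local Notation I := (@unitI R).
Implicit Types a b : R -> G.

Lemma is_pathE a : is_path a <-> continuous (a \o @clamp R).
Proof.
exact: (within_retract_continuous _ (@clamp_continuous R) (@clamp_unitI R)
  (@clamp_id R)).
Qed.

Lemma is_path_eq a b : is_path a -> (forall t, I t -> a t = b t) -> is_path b.
Proof.
by move=> pa ab; apply: subspace_eq_continuous pa => t /set_mem; exact: ab.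
Qed.

Lemma is_path_comp a (f : R -> R) :
  continuous f -> (forall t, I (f t)) -> is_path a -> is_path (a \o f).
Proof.
move=> fc fI /is_pathE ac; apply: continuous_subspaceT.
have -> : a \o f = (a \o @clamp R) \o f.
  by apply: funext => u /=; rewrite clamp_id.
by move=> t; apply: continuous_comp; [exact: fc|exact: ac].
Qed.

Lemma homotopicP a b : path_homotopic a b <->
  exists F : R * R -> G, continuous F /\
    (forall t, I t -> F (0, t) = a t /\ F (1, t) = b t) /\
    (forall s, I s -> F (s, 0) = a 0 /\ F (s, 1) = a 1).
Proof.
pose r (st : R * R) := (clamp st.1, clamp st.2).
have rc : continuous r.
  apply: pair_continuous => st.
    exact: (continuous_comp (f := fst) cvg_fst (@clamp_continuous R _)).
  exact: (continuous_comp (f := snd) cvg_snd (@clamp_continuous R _)).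
split=> -[F [Fc [Fv Fh]]]; last first.
  by exists F; split => //; exact: continuous_subspaceT.
exists (F \o r); split.
  apply: (proj1 (@within_retract_continuous _ _ (I `*` I) r F rc _ _) Fc).
    by move=> st; split; exact: clamp_unitI.
  by move=> [s t] [/= sI tI]; rewrite /r /= !clamp_id.
by split=> t tI; rewrite /= /r /= !clamp_id //; [exact: Fv|exact: Fh].
Qed.

(** At the corners (1,0) and (1,1) of the square both boundary conditions on the homotopy apply. *)
Lemma homotopic_endpoints a b :
  path_homotopic a b -> a 0 = b 0 /\ a 1 = b 1.
Proof.
move=> [F [_ [Fv Fh]]]; split.
  by rewrite -(Fv 0 (unitI0 R)).2 (Fh 1 (unitI1 R)).1.
by rewrite -(Fv 1 (unitI1 R)).2 (Fh 1 (unitI1 R)).2.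
Qed.

Lemma homotopic_is_path a b : path_homotopic a b -> is_path a /\ is_path b.
Proof.
move=> /homotopicP [F [Fc [Fv _]]].
have Fs s : is_path (fun t => F (s, t)).
  apply: continuous_subspaceT => t.
  apply: (@continuous_comp _ _ _ (fun t => (s, t)) F); last exact: Fc.
  by apply: pair_continuous => u; [exact: cvg_cst|exact: cvg_id].
by split; [apply: (is_path_eq (Fs 0))|apply: (is_path_eq (Fs 1))] => t /Fv[].
Qed.

(** The homotopy is constant in its first variable. This is how a pointwise identity on [0,1] is
    turned into a homotopy. *)
Lemma homotopic_eq a b :
  is_path a -> (forall t, I t -> a t = b t) -> path_homotopic a b.
Proof.
move=> /is_pathE ac ab; apply/homotopicP; exists (a \o @clamp R \o snd).
split; first by move=> st; apply: continuous_comp; [exact: cvg_snd|exact: ac].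
by split=> t tI; rewrite /= !clamp_id //; split => //; exact: ab.
Qed.

Lemma homotopic_refl a : is_path a -> path_homotopic a a.
Proof. by move=> pa; exact: homotopic_eq. Qed.

(* The straight-line homotopy between the two parameter changes. *)
Lemma homotopic_reparam a (f g : R -> R) : is_path a ->
  continuous f -> continuous g -> (forall t, I (f t)) -> (forall t, I (g t)) ->
  f 0 = g 0 -> f 1 = g 1 -> path_homotopic (a \o f) (a \o g).
Proof.
move=> /is_pathE ac fc gc fI gI fg0 fg1; apply/homotopicP.
pose L (st : R * R) : R := (1 - st.1) * f st.2 + st.1 * g st.2.
have Lc : continuous L.
  move=> st; apply: (@cvgD _ R^o); apply: (@cvgM R).
  - by apply: (@cvgB _ R^o); [exact: cvg_cst|exact: cvg_fst].
  - exact: (continuous_comp (f := snd) cvg_snd (fc _)).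
  - exact: cvg_fst.
  - exact: (continuous_comp (f := snd) cvg_snd (gc _)).
exists (a \o @clamp R \o L); split.
  by move=> st; apply: continuous_comp; [exact: Lc|exact: ac].
split=> [t tI|s sI]; rewrite /= /L /=.
  by rewrite subr0 mul1r mul0r addr0 subrr mul0r add0r mul1r !clamp_id.
by rewrite -fg0 -fg1 -!mulrDl subrK !mul1r !clamp_id.
Qed.

End PathsAndHomotopies.

(** * Pointwise products of paths and homotopies in the group *)

Section GroupPaths.
Variables (R : realType) (G : topologicalType) (TG : topGroup G).
Local Notation I := (@unitI R).
Local Notation "x ** y" := (tg_mul TG x y) (at level 40, left associativity).
Local Notation V := (tg_inv TG).
Local Notation e := (tg_one TG).
Implicit Types (a b : R -> G) (x y z : G).

Lemma tg_mulAr x y z : (x ** y) ** z = x ** (y ** z).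
Proof. by rewrite tg_mulA. Qed.

Lemma tg_mulKg x y : V x ** (x ** y) = y.
Proof. by rewrite tg_mulA tg_mulVg tg_mul1g. Qed.

Lemma tg_mulKVg x y : x ** (V x ** y) = y.
Proof. by rewrite tg_mulA tg_mulgV tg_mul1g. Qed.

(** A rewriting system that associates products to the right and cancels adjacent inverses; it
    settles the pointwise identities below. *)
Definition tg_simp := (tg_mulAr, tg_mulKg, tg_mulKVg, tg_mulVg TG,
  tg_mulgV TG, tg_mul1g TG, tg_mulg1 TG).

Lemma continuous_tg_mul (T : topologicalType) (f g : T -> G) :
  continuous f -> continuous g -> continuous (fun t => f t ** g t).
Proof.
move=> fc gc t.
apply: (continuous_comp (f := fun t => (f t, g t))
  (g := fun xy => xy.1 ** xy.2)); first exact: pair_continuous.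
exact: tg_mul_cont.
Qed.

Lemma continuous_tg_inv (T : topologicalType) (f : T -> G) :
  continuous f -> continuous (fun t => V (f t)).
Proof.
move=> fc t; apply: continuous_comp (fc t) _; exact: tg_inv_cont.
Qed.

Lemma is_path_mul a b : is_path a -> is_path b -> is_path (fun t => a t ** b t).
Proof.
by move=> /is_pathE ? /is_pathE ?; apply/is_pathE; exact: continuous_tg_mul.
Qed.

Lemma is_path_inv a : is_path a -> is_path (fun t => V (a t)).
Proof. by move=> /is_pathE ?; apply/is_pathE; exact: continuous_tg_inv. Qed.

Lemma is_path_mulr a x : is_path a -> is_path (fun t => a t ** x).
Proof. by move=> pa; apply: is_path_mul => //; exact: cst_is_path. Qed.

Lemma homotopic_mul a b c d : path_homotopic a b -> path_homotopic c d ->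
  path_homotopic (fun t => a t ** c t) (fun t => b t ** d t).
Proof.
move=> /homotopicP[E [Ec [Ev Eh]]] /homotopicP[F [Fc [Fv Fh]]].
apply/homotopicP; exists (fun st => E st ** F st); split.
  exact: continuous_tg_mul.
split=> [t tI|s sI].
  by case: (Ev t tI) => -> ->; case: (Fv t tI) => -> ->.
by case: (Eh s sI) => -> ->; case: (Fh s sI) => -> ->.
Qed.

Lemma homotopic_inv a b : path_homotopic a b ->
  path_homotopic (fun t => V (a t)) (fun t => V (b t)).
Proof.
move=> /homotopicP[F [Fc [Fv Fh]]].
apply/homotopicP; exists (fun st => V (F st)); split.
  exact: continuous_tg_inv.
split=> [t tI|s sI].
  by case: (Fv t tI) => -> ->.
by case: (Fh s sI) => -> ->.
Qed.

(* Homotopies F : a ~ b and F' : b ~ c combine into F b^-1 F' : a ~ c, so no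
   pasting is needed; likewise b F^-1 a runs from b to a. *)
Lemma homotopic_trans a b c :
  path_homotopic a b -> path_homotopic b c -> path_homotopic a c.
Proof.
move=> ab bc; have [_ pb] := homotopic_is_path ab.
have [pa _] := homotopic_is_path ab; have [_ pc] := homotopic_is_path bc.
have := homotopic_mul (homotopic_mul ab (homotopic_inv (homotopic_refl pb))) bc.
move=> /homotopicP [F [Fc [Fv Fh]]]; apply/homotopicP; exists F; split=> //.
have [a0 a1] := homotopic_endpoints ab.
split=> [t tI|s sI]; [have := Fv t tI|have := Fh s sI];
  by rewrite ?a0 ?a1 !tg_simp.
Qed.

Lemma homotopic_sym a b : path_homotopic a b -> path_homotopic b a.
Proof.
move=> ab; have [pa pb] := homotopic_is_path ab.
have := homotopic_mul (homotopic_mul (homotopic_refl pb) (homotopic_inv ab))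
  (homotopic_refl pa).
move=> /homotopicP [F [Fc [Fv Fh]]]; apply/homotopicP; exists F; split=> //.
have [a0 a1] := homotopic_endpoints ab.
split=> [t tI|s sI]; [have := Fv t tI|have := Fh s sI];
  by rewrite ?a0 ?a1 !tg_simp.
Qed.

Lemma homotopic_mulr a b x :
  path_homotopic a b -> path_homotopic (fun t => a t ** x) (fun t => b t ** x).
Proof.
by move=> ab; have := homotopic_mul ab (homotopic_refl (@cst_is_path R G x)).
Qed.

(** * Concatenation as a pointwise product *)

Lemma concat0 a b : concat a b 0 = b 0.
Proof. by rewrite /concat invr_ge0 ler0n mulr0. Qed.

Lemma concat1 a b : concat a b 1 = a 1.
Proof.
rewrite /concat ifF; last by apply/negbTE; rewrite -ltNge; lra.
by congr a; lra.
Qed.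

Lemma path_in_concat (A : set G) a b :
  path_in A a -> path_in A b -> path_in A (concat a b).
Proof.
move=> Aa Ab t; rewrite /concat /unitI /= => /andP[t0 t1].
case: ifPn => [t2|]; last rewrite -ltNge => t2.
  by apply: Ab; rewrite /unitI /=; apply/andP; split; lra.
by apply: Aa; rewrite /unitI /=; apply/andP; split; lra.
Qed.

(** An interchange law: both sides select the same half of the interval. *)
Lemma concat_mul a b c d t :
  concat (fun t => a t ** b t) (fun t => c t ** d t) t
  = concat a c t ** concat b d t.
Proof. by rewrite /concat; case: ifP. Qed.

(** On [0,1], [lo] runs during the first half and then rests at 1, while [hi] rests at 0 and runs
    during the second half. *)
Let lo (t : R) := clamp (2 * t).
Let hi (t : R) := clamp (2 * t - 1).

Lemma lo_continuous : continuous lo.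
Proof.
move=> t; apply: (continuous_comp (f := fun t : R => 2 * t) (g := @clamp R)).
  by apply: (@cvgM R); [exact: cvg_cst|exact: cvg_id].
exact: clamp_continuous.
Qed.

Lemma hi_continuous : continuous hi.
Proof.
move=> t.
apply: (continuous_comp (f := fun t : R => 2 * t - 1) (g := @clamp R)).
  apply: (@cvgB _ R^o); last exact: cvg_cst.
  by apply: (@cvgM R); [exact: cvg_cst|exact: cvg_id].
exact: clamp_continuous.
Qed.

(** In each half one of the two outer factors rests at the common point [a 0 = b 1] and cancels
    against the middle factor. *)
Lemma concatE a b t : a 0 = b 1 -> I t ->
  concat a b t = a (hi t) ** V (a 0) ** b (lo t).
Proof.
rewrite /concat /unitI /= /hi /lo => ab /andP[t0 t1].
case: ifPn => [t2|]; last rewrite -ltNge => t2.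
  rewrite (@clamp_le0 _ (2 * t - 1)) ?tg_simp ?clamp_id //; last by lra.
  by rewrite /unitI /=; apply/andP; split; lra.
rewrite (@clamp_ge1 _ (2 * t)) ?ab ?tg_simp ?clamp_id //; last by lra.
by rewrite /unitI /=; apply/andP; split; lra.
Qed.

Lemma concat_homotopic a b : is_path a -> is_path b -> a 0 = b 1 ->
  path_homotopic (concat a b) (fun t => a t ** V (a 0) ** b t).
Proof.
move=> pa pb ab.
have phi : is_path (a \o hi).
  by apply: is_path_comp pa => // t; [exact: hi_continuous|exact: clamp_unitI].
have plo : is_path (b \o lo).
  by apply: is_path_comp pb => // t; [exact: lo_continuous|exact: clamp_unitI].
have hc : path_homotopic (fun t => (a \o hi) t ** V (a 0) ** (b \o lo) t)
    (concat a b).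
  apply: homotopic_eq => [|t tI]; last by rewrite concatE.
  by apply: is_path_mul => //; exact: is_path_mulr.
apply: homotopic_trans (homotopic_sym hc) _.
have ha : path_homotopic (a \o hi) a.
  (* [clamp] replaces the identity parameter change, since [homotopic_reparam] asks for maps of the
     whole line into [0,1]. *)
  apply: homotopic_trans (_ : path_homotopic (a \o @clamp R) a).
    apply: homotopic_reparam => //; [exact: hi_continuous
      |exact: clamp_continuous|by move=> t; exact: clamp_unitI| |].
      by rewrite /hi !clamp_le0 //; lra.
    by rewrite /hi !clamp_ge1 //; lra.
  apply: homotopic_eq => [|t tI /=]; last by rewrite clamp_id.
  by apply: is_path_comp => //; exact: clamp_continuous.
have hb : path_homotopic (b \o lo) b.
  apply: homotopic_trans (_ : path_homotopic (b \o @clamp R) b).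
    apply: homotopic_reparam => //; [exact: lo_continuous
      |exact: clamp_continuous|by move=> t; exact: clamp_unitI| |].
      by rewrite /lo !clamp_le0 //; lra.
    by rewrite /lo !clamp_ge1 //; lra.
  apply: homotopic_eq => [|t tI /=]; last by rewrite clamp_id.
  by apply: is_path_comp => //; exact: clamp_continuous.
exact: homotopic_mul (homotopic_mulr _ ha) hb.
Qed.

Lemma is_path_concat a b : is_path a -> is_path b -> a 0 = b 1 ->
  is_path (concat a b).
Proof.
by move=> pa pb ab; exact: (homotopic_is_path (concat_homotopic pa pb ab)).1.
Qed.

(** * Reversed paths and null loops *)

Lemma is_path_reverse a : is_path a -> is_path (reverse_path a).
Proof.
move=> pa; apply: (@is_path_eq _ _ (a \o (fun t => clamp (1 - t)))).
  apply: is_path_comp => // t.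
  apply: (continuous_comp (f := fun t : R => 1 - t) (g := @clamp R));
    last exact: clamp_continuous.
  by apply: (@cvgB _ R^o); [exact: cvg_cst|exact: cvg_id].
move=> t /andP[t0 t1]; rewrite /reverse_path /= clamp_id // /unitI /=.
by apply/andP; split; lra.
Qed.

Lemma reverse_path0 a : reverse_path a 0 = a 1.
Proof. by rewrite /reverse_path subr0. Qed.

Lemma reverse_path1 a : reverse_path a 1 = a 0.
Proof. by rewrite /reverse_path subrr. Qed.

Lemma path_in_reverse (A : set G) a : path_in A a -> path_in A (reverse_path a).
Proof.
move=> Aa t /andP[t0 t1]; apply: Aa; rewrite /unitI /=.
by apply/andP; split; lra.
Qed.

(* [a] followed back by its reverse is [a] along the tent-shaped parameter
   change, which contracts to the constant 1; now solve for the reverse. *)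
Lemma reverse_homotopic a : is_path a ->
  path_homotopic (reverse_path a) (fun t => a 0 ** V (a t) ** a 1).
Proof.
move=> pa; have pr := is_path_reverse pa.
pose f (t : R) := clamp `|2 * t - 1|.
have fc : continuous f.
  move=> t; apply: (continuous_comp (f := fun t : R => `|2 * t - 1|)
    (g := @clamp R)).
    apply: (continuous_comp (f := fun t : R => 2 * t - 1)
      (g := fun t : R => `|t|)).
      apply: (@cvgB _ R^o); last exact: cvg_cst.
      by apply: (@cvgM R); [exact: cvg_cst|exact: cvg_id].
    exact: norm_continuous.
  exact: clamp_continuous.
have h1 : path_homotopic (a \o f) (a \o cst 1).
  apply: homotopic_reparam => //; rewrite /f.
  - by move=> t; exact: cvg_cst.
  - by move=> t; exact: clamp_unitI.
  - by rewrite mulr0 sub0r normrN1 clamp_ge1.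
  - by rewrite clamp_ge1 // ger0_norm; lra.
have h2 : path_homotopic (concat a (reverse_path a)) (a \o cst 1).
  apply: homotopic_trans h1; apply: homotopic_eq.
    by apply: is_path_concat => //; rewrite reverse_path1.
  move=> t /andP[t0 t1]; rewrite /concat /reverse_path /f /=.
  case: ifPn => [t2|]; last rewrite -ltNge => t2.
    rewrite ler0_norm ?opprB ?clamp_id //; last by lra.
    by rewrite /unitI /=; apply/andP; split; lra.
  rewrite ger0_norm ?clamp_id //; last by lra.
  by rewrite /unitI /=; apply/andP; split; lra.
have h3 := concat_homotopic pa pr (esym (reverse_path1 a)).
have h4 := homotopic_trans (homotopic_sym h3) h2.
(* Multiplying [h4] on the left by this path cancels [a t ** V (a 0)] and isolates the reverse. *)
have pi : is_path (fun t => a 0 ** V (a t)).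
  by apply: is_path_mul; [exact: cst_is_path|exact: is_path_inv].
have h5 := homotopic_mul (homotopic_refl pi) h4.
apply: homotopic_trans h5; apply: homotopic_eq => // t tI.
by rewrite !tg_simp.
Qed.

(** Allows the factors to be replaced by homotopic ones, so that nested concatenations expand from
    the inside out. *)
Lemma concat_homotopic2 a a' b b' :
  path_homotopic a a' -> path_homotopic b b' -> a 0 = b 1 ->
  path_homotopic (concat a b) (fun t => a' t ** V (a 0) ** b' t).
Proof.
move=> aa bb ab; have [pa _] := homotopic_is_path aa.
have [pb _] := homotopic_is_path bb.
apply: homotopic_trans (concat_homotopic pa pb ab) _.
exact: homotopic_mul (homotopic_mulr _ aa) bb.
Qed.

(** All factors but the last cancel in the product formula. The three-legged shape of this null loop
    matches that of the elements of [Nset], so the two can be multiplied leg by leg. *)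
Lemma concat_cst_reverse a : is_path a ->
  path_homotopic (concat a (concat (cst (a 0)) (reverse_path a))) (cst (a 1)).
Proof.
move=> pa; have pr := is_path_reverse pa.
have pc : is_path (cst (a 0) : R -> G) := @cst_is_path R G (a 0).
have := concat_homotopic2 (homotopic_refl pa)
  (concat_homotopic2 (homotopic_refl pc) (reverse_homotopic pa) _) _.
rewrite concat1 reverse_path1 => /(_ erefl erefl) h.
have [_ ph] := homotopic_is_path h.
apply: homotopic_trans h _; apply: homotopic_eq => // t tI /=.
by rewrite !tg_simp.
Qed.

(** * Homotopy classes and their representatives *)

Lemma pclass_homotopic a b : path_homotopic a b -> pclass a = pclass b.
Proof.
move=> ab; apply/seteqP; split=> c [pc h]; split => //.
  exact: homotopic_trans ab.
exact: homotopic_trans (homotopic_sym ab).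
Qed.

Lemma homotopic_pclass a b :
  is_path a -> pclass a = pclass b -> path_homotopic a b.
Proof.
move=> pa ab; have : pclass a a by split => //; exact: homotopic_refl.
by rewrite ab => -[].
Qed.

Lemma sval_cls a : is_path a -> proj1_sig (cls a) = pclass a.
Proof. by move=> pa; rewrite /cls; case: pselect. Qed.

Lemma Pi1_inj (c d : Pi1 R G) : proj1_sig c = proj1_sig d -> c = d.
Proof. by case: c d => [C pC] [D pD] /= CD; exact: eq_exist. Qed.

Lemma rep_is_path (c : Pi1 R G) : is_path (rep c).
Proof. by rewrite /rep; case: cid2. Qed.
Arguments rep_is_path : clear implicits.

Lemma pclass_rep (c : Pi1 R G) : pclass (rep c) = proj1_sig c.
Proof. by rewrite /rep; case: cid2. Qed.

Lemma cls_rep (c : Pi1 R G) : cls (rep c) = c.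
Proof.
by apply: Pi1_inj; rewrite sval_cls ?pclass_rep //; exact: rep_is_path.
Qed.

Lemma cls_homotopic a b : path_homotopic a b -> cls a = cls b.
Proof.
move=> ab; have [pa pb] := homotopic_is_path ab.
by apply: Pi1_inj; rewrite !sval_cls //; exact: pclass_homotopic.
Qed.

Lemma rep_cls a : is_path a -> path_homotopic (rep (cls a)) a.
Proof.
move=> pa; apply: homotopic_pclass; first exact: rep_is_path.
by rewrite pclass_rep sval_cls.
Qed.

Lemma rep_cls0 a : is_path a -> rep (cls a) 0 = a 0.
Proof. by move=> /rep_cls /homotopic_endpoints []. Qed.

Lemma rep_cls1 a : is_path a -> rep (cls a) 1 = a 1.
Proof. by move=> /rep_cls /homotopic_endpoints []. Qed.

(** * Right translation of classes by group elements *)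

Definition rtranslate (cg : Pi1 R G * G) : Pi1 R G :=
  cls (fun t => rep cg.1 t ** cg.2).

Lemma rtranslate_cls a x : is_path a ->
  rtranslate (cls a, x) = cls (fun t => a t ** x).
Proof. by move=> pa; apply/cls_homotopic/homotopic_mulr/rep_cls. Qed.

Lemma rtranslateM (c : Pi1 R G) x y :
  rtranslate (rtranslate (c, x), y) = rtranslate (c, x ** y).
Proof.
have pc : is_path (fun t => rep c t ** x) by exact/is_path_mulr/rep_is_path.
rewrite (rtranslate_cls _ pc); apply/cls_homotopic/homotopic_eq.
  exact: is_path_mulr.
by move=> t _; rewrite /= tg_mulA.
Qed.

Lemma rtranslate1 (c : Pi1 R G) : rtranslate (c, e) = c.
Proof.
rewrite -[RHS]cls_rep; apply/cls_homotopic/homotopic_eq.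
  exact/is_path_mulr/rep_is_path.
by move=> t _; rewrite /= tg_mulg1.
Qed.

Lemma gpd_src_rtranslate (c : Pi1 R G) x :
  gpd_src (rtranslate (c, x)) = gpd_src c ** x.
Proof. by rewrite /gpd_src rep_cls0 //; exact/is_path_mulr/rep_is_path. Qed.

(** * Basic neighbourhoods and continuity for the UC topology *)

Lemma Nset_path_class (s : R -> G) (A B : set G) :
  is_path s -> A (s 1) -> B (s 0) -> Nset s A B (cls s).
Proof.
move=> ps As Bs; have p1 := @cst_is_path R G (s 1).
have p0 := @cst_is_path R G (s 0).
(* Both outer legs are constant and disappear in the product formula. *)
exists (cst (s 1)), (cst (s 0)); split; [by split|by split|].
rewrite sval_cls //; apply/pclass_homotopic/homotopic_sym.
have := concat_homotopic2 (homotopic_refl p1)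
  (concat_homotopic2 (homotopic_refl ps) (homotopic_refl p0) _) _.
rewrite concat1 => /(_ erefl erefl) h; have [_ ph] := homotopic_is_path h.
apply: homotopic_trans h _; apply: homotopic_eq => // t _ /=.
by rewrite !tg_simp.
Qed.

Lemma Nset_cls (s : R -> G) (A B : set G) (c : Pi1 R G) :
  is_path s -> Nset s A B c -> exists d th : R -> G,
    [/\ [/\ is_path d, path_in A d & d 0 = s 1],
        [/\ is_path th, path_in B th & th 1 = s 0] &
        path_homotopic (rep c) (concat d (concat s th))].
Proof.
move=> ps [d [th [hd hth E]]]; exists d, th; split => //.
by apply: homotopic_pclass; [exact: rep_is_path|rewrite pclass_rep].
Qed.

Lemma uc_subbase_open (N : set (Pi1 R G)) : uc_subbase N -> open N.
Proof.
move=> sN; exists [set N]; last first.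
  by apply/seteqP; split=> [c [_ -> //]|c Nc]; exists N.
move=> _ ->; exists [fset N]%fset.
  by move=> M; rewrite in_fset1 => /eqP ->; exact: mem_set.
apply/seteqP; split=> [c|c Nc M /=]; first by apply; rewrite /= in_fset1.
by rewrite /= in_fset1 => /eqP ->.
Qed.

(** Every neighbourhood of [f t] contains a finite intersection of subbasic sets around [f t], and
    taking preimages commutes with intersections. *)
Lemma Pi1_continuous (T : topologicalType) (f : T -> Pi1 R G) :
  (forall t N, uc_subbase N -> N (f t) -> nbhs t (f @^-1` N)) -> continuous f.
Proof.
move=> fN t A /=; rewrite (@nbhsE (Pi1 R G)) nbhs_simpl /=.
move=> [_ [[B sB <-] [C BC Cft] sUBA]].
apply: (@filterS _ _ _ (f @^-1` C)) => [u Cfu|]; first by apply: sUBA; exists C.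
have /sB [D sD IDeC] := BC; rewrite -IDeC.
have -> : f @^-1` (\bigcap_(i in [set` D]) id i)
    = \bigcap_(i in [set` D]) (f @^-1` i) by [].
apply: filter_bigI => N DN; apply: fN; first exact: set_mem (sD _ DN).
by move: Cft; rewrite -IDeC => /(_ _ DN).
Qed.

(** * Joint continuity of right translation, and continuity of the source *)

Section LocallySimple.
Hypothesis lpc : locally_path_connected R G.
Hypothesis slsc : semilocally_simply_connected R G.

(* A loop at [y] in [W] is conjugated by a path in [W] to a loop at [x]. *)
Lemma rel_inessential_nbhs x (U : set G) : nbhs x U ->
  exists W, [/\ open W, W x, W `<=` U, path_connected_set R W &
    rel_inessential R W].
Proof.
move=> xU; have [S [oS Sx Str]] := slsc x.
have [W [oW Wx WUS Wpc]] : exists W, [/\ open W, W x, W `<=` U `&` S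
    & path_connected_set R W].
  by apply: lpc; apply: filterI => //; exact: open_nbhs_nbhs.
exists W; split => //; first by move=> y /WUS[].
move=> y Wy a pa Wa a0 a1; have [b [pb Wb b0 b1]] := Wpc x y Wx Wy.
have pr := is_path_reverse pb.
have WS (d : R -> G) : path_in W d -> path_in S d by move=> Wd t /Wd /WUS[].
have ra : reverse_path b 0 = concat a b 1 by rewrite reverse_path0 concat1 a1.
have pab : is_path (concat a b) by apply: is_path_concat => //; rewrite a0.
have h := concat_homotopic2 (reverse_homotopic pb)
  (concat_homotopic pa pb (etrans a0 (esym b1))) ra.
have hx : path_homotopic (concat (reverse_path b) (concat a b)) (cst x).
  apply: Str; first exact: is_path_concat.
  - apply: WS; apply: path_in_concat (path_in_concat _ _) => //.
    exact: path_in_reverse.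
  - by rewrite !concat0.
  - by rewrite concat1 reverse_path1.
have k := homotopic_trans (homotopic_sym h) hx.
(* By the product formula the conjugated loop is [x * b^-1 * a * y^-1 * b], up to homotopy.
   Multiplying by [b * x^-1] on the left and [b^-1 * y] on the right recovers [a] and turns the
   constant [x] into [y]. *)
have pl : is_path (fun t => b t ** V x) by exact: is_path_mulr.
have prr : is_path (fun t => V (b t) ** y) by exact/is_path_mulr/is_path_inv.
have := homotopic_mul (homotopic_mul (homotopic_refl pl) k)
  (homotopic_refl prr).
move=> m; have [pm1 pm2] := homotopic_is_path m.
apply: homotopic_trans (homotopic_trans _ m) _.
  by apply: homotopic_eq => // t _; rewrite b0 b1 a0 reverse_path0 b1 !tg_simp.
by apply: homotopic_eq => // t _; rewrite /= !tg_simp.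
Qed.

(* Translating [d □ (s □ th)] by [x] amounts to multiplying it by the null loop
   [w □ (x0 □ w^-1)], with [w] a short path from [x0] to [x]; concatenation
   commutes with pointwise products, so only the two outer legs move. *)
Lemma rtranslate_continuous : continuous rtranslate.
Proof.
apply: Pi1_continuous => -[c0 x0] _ [s [A [B [ps [oA As _ _] [oB Bs _ _] ->]]]].
move=> /(Nset_cls ps) [d1 [th1 [[pd1 Ad1 d10] [pth1 Bth1 th11] h1]]].
set g := rep c0; have pg : is_path g := rep_is_path c0.
have pgx : is_path (fun t => g t ** x0) by exact: is_path_mulr.
have {}h1 := homotopic_trans (homotopic_sym (rep_cls pgx)) h1.
have [] := homotopic_endpoints h1; rewrite !concat0 !concat1 => th10 d11.
(* Continuity of the multiplication at [(g 1, x0)] and [(g 0, x0)] keeps the translated outer legs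
   inside [A] and [B]. *)
have mA : nbhs (g 1, x0) (fun xy => A (xy.1 ** xy.2)).
  apply: (@tg_mul_cont _ TG); apply: open_nbhs_nbhs; split => //=.
  by rewrite d11; exact: Ad1.
have mB : nbhs (g 0, x0) (fun xy => B (xy.1 ** xy.2)).
  apply: (@tg_mul_cont _ TG); apply: open_nbhs_nbhs; split => //=.
  by rewrite th10; exact: Bth1.
have [[A0 W0] /= [nA0 nW0] A0W0] := mA.
have [[B1 W1] /= [nB1 nW1] B1W1] := mB.
(* [A'] and [B'] must be admissible for the UC subbase; [W] must be path connected to provide the
   path [w] from [x0] to [x]. *)
have [A' [oA' A'g sA' A'pc A'ri]] := rel_inessential_nbhs nA0.
have [B' [oB' B'g sB' B'pc B'ri]] := rel_inessential_nbhs nB1.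
have [W [oW Wx sW Wpc]] := lpc (filterI nW0 nW1).
exists (Nset g A' B', W) => /=.
  split; last exact: open_nbhs_nbhs.
  apply: open_nbhs_nbhs; split.
    by apply: uc_subbase_open; exists g, A', B'.
  by rewrite -[c0]cls_rep; exact: Nset_path_class.
move=> [c x] /= [/(Nset_cls pg) [d [th [[pd A'd d0] [pth B'th th1' ] hc]]] Wx'].
have [w [pw Ww w0 w1]] := Wpc _ _ Wx Wx'.
have pr := is_path_reverse pw.
pose D t := d t ** w t; pose T t := th t ** reverse_path w t.
have pD : is_path D by exact: is_path_mul.
have pT : is_path T by exact: is_path_mul.
have AD : path_in A D.
  by move=> t tI; apply: (A0W0 (_, _)); split=> /=;
    [exact/sA'/A'd|case: (sW _ (Ww t tI))].
have BT : path_in B T.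
  by move=> t tI; apply: (B1W1 (_, _)); split=> /=;
    [exact/sB'/B'th|case: (sW _ (path_in_reverse Ww tI))].
have D0 : D 0 = d1 1 by rewrite /D d0 w0.
have T1 : T 1 = th1 0 by rewrite /T reverse_path1 th1' w0.
(* The legs [d1] and [th1] lead from the ends of [s] to those of [g] translated by [x0]; [D] and [T]
   extend them to the ends of the translate of [c] by [x]. *)
exists (concat D d1), (concat th1 T); split.
- by split; [exact: is_path_concat|exact: path_in_concat|rewrite concat0].
- by split; [exact: is_path_concat|exact: path_in_concat|rewrite concat1].
rewrite sval_cls /=; last exact/is_path_mulr/rep_is_path.
apply: pclass_homotopic.
have k1 : path_homotopic (fun t => rep c t ** x)
    (concat D (concat (fun t => g t ** x0) T)).
  have := homotopic_mul hc (homotopic_sym (concat_cst_reverse pw)).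
  rewrite w1 w0; congr path_homotopic; apply: funext => t.
  by rewrite -concat_mul /D /T; congr (concat _ _ t); apply: funext => u;
    rewrite -concat_mul.
have hs := homotopic_refl ps; have hd1 := homotopic_refl pd1.
have hth1 := homotopic_refl pth1; have hD := homotopic_refl pD.
have hT := homotopic_refl pT.
(* [k5] and [l3] expand the two bracketings of [D], [d1], [s], [th1], [T] into the same pointwise
   product, so reassociation reduces to associativity in the group. *)
have k2 := concat_homotopic2 hs hth1 (esym th11).
have := concat_homotopic2 hd1 k2 _; rewrite concat1 => /(_ d10) k3.
have k4 := concat_homotopic2 (homotopic_trans h1 k3) hT (etrans th10 (esym T1)).
have := concat_homotopic2 hD k4 _; rewrite concat1 d11 => /(_ D0) k5.
have l1 := concat_homotopic2 hth1 hT (esym T1).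
have := concat_homotopic2 hs l1 _; rewrite concat1 => /(_ (esym th11)) l2.
have := concat_homotopic2 (concat_homotopic2 hD hd1 D0) l2 _.
rewrite concat0 concat1 => /(_ d10) l3.
apply: homotopic_trans k1 (homotopic_trans k5 (homotopic_sym _)).
have [_ pl] := homotopic_is_path l3.
apply: homotopic_trans l3 _; apply: homotopic_eq => // t _.
by rewrite th10 !tg_mulAr.
Qed.

(** Classes in [Nset (rep c) A B] start where their leg [th] starts, hence in [B], which can be
    chosen inside the given neighbourhood. *)
Lemma gpd_src_continuous : continuous (@gpd_src R G).
Proof.
move=> c U nU; have [B [oB Bc sB Bpc Bri]] := rel_inessential_nbhs nU.
(* The range is unconstrained, but a subbasic set also requires an admissible neighbourhood at that
   end. *)
have [A [oA Ac _ Apc Ari]] :=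
  rel_inessential_nbhs (@filterT _ (nbhs (rep c 1)) _).
apply: (@filterS _ _ _ (Nset (rep c) A B)).
  move=> c' /(Nset_cls (rep_is_path c)) [d [th [_ [_ Bth _] h]]]; apply: sB.
  by rewrite /gpd_src (homotopic_endpoints h).1 !concat0; exact: Bth.
apply: open_nbhs_nbhs; split.
  apply: uc_subbase_open; exists (rep c), A, B; split => //.
  exact: rep_is_path.
rewrite -[X in Nset _ _ _ X]cls_rep; apply: Nset_path_class => //.
exact: rep_is_path.
Qed.

End LocallySimple.

(** * The algebraic isomorphism and its inverse *)

Lemma tg_invM x y : V (x ** y) = V y ** V x.
Proof.
by rewrite -[RHS](tg_mulg1 TG) -(tg_mulgV TG (x ** y)) !tg_simp.
Qed.

Implicit Types h k : Htype R TG.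

Lemma rep_Htype0 h : rep (set_val h) 0 = e.
Proof. exact: set_mem (valP h). Qed.

(** A product of two paths starting at the identity starts there too, which excludes the fallback
    branch of [H_mul]. *)
Lemma set_val_H_mul h k :
  set_val (H_mul h k) = cls (fun t => rep (set_val h) t ** rep (set_val k) t).
Proof.
rewrite /H_mul; case: pselect => // -[]; rewrite /Hset /= rep_cls0.
  by rewrite !rep_Htype0 tg_mul1g.
by apply: is_path_mul; exact: rep_is_path.
Qed.

Lemma set_val_H_inv h :
  set_val (H_inv h) = cls (fun t => V (rep (set_val h) t)).
Proof.
rewrite /H_inv; case: pselect => // -[]; rewrite /Hset /= rep_cls0.
  by rewrite rep_Htype0 -[LHS](tg_mul1g TG) tg_mulgV.
by apply: is_path_inv; exact: rep_is_path.
Qed.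

Lemma JmapE (x : Htype R TG * G) : Jmap x = rtranslate (set_val x.1, x.2).
Proof. by []. Qed.

Lemma Hset_normalize (c : Pi1 R G) : Hset TG (rtranslate (c, V (gpd_src c))).
Proof. by rewrite /Hset /= [LHS]gpd_src_rtranslate tg_mulgV. Qed.

Definition Jinv (c : Pi1 R G) : Htype R TG * G :=
  (SigSub (mem_set (Hset_normalize c)), gpd_src c).

Lemma gpd_src_Jmap (x : Htype R TG * G) : gpd_src (Jmap x) = x.2.
Proof. by rewrite JmapE gpd_src_rtranslate /gpd_src rep_Htype0 tg_mul1g. Qed.

(** The source of [Jmap (h, g)] is [g], so [Jinv] translates back by exactly [g^-1]. *)
Lemma JmapK : cancel (@Jmap R G TG) Jinv.
Proof.
case=> h g; rewrite /Jinv; congr pair; last exact: gpd_src_Jmap.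
apply: val_inj => /=; rewrite gpd_src_Jmap JmapE rtranslateM tg_mulgV.
exact: rtranslate1.
Qed.

Lemma JinvK : cancel Jinv (@Jmap R G TG).
Proof. by move=> c; rewrite JmapE rtranslateM tg_mulVg rtranslate1. Qed.

Lemma gpd_rng_Jmap (x : Htype R TG * G) : gpd_rng (Jmap x) = tg_rng x.
Proof. by rewrite /gpd_rng rep_cls1 //; exact/is_path_mulr/rep_is_path. Qed.

(** The first factor starts at [g], so the product formula gives [h * g * g^-1 * k * g'], which is
    [h * k * g']. *)
Lemma Jmap_mul (x y : Htype R TG * G) : tg_composable x y ->
  Jmap (tg_gmul x y) = gpd_mul (Jmap x) (Jmap y).
Proof.
case: x y => [h g] [k g']; rewrite /tg_composable /= => gE.
have ph := rep_is_path (set_val h); have pk := rep_is_path (set_val k).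
rewrite JmapE /= set_val_H_mul rtranslate_cls; last exact: is_path_mul.
apply/cls_homotopic/homotopic_sym.
have := concat_homotopic2 (rep_cls (is_path_mulr (x := g) ph))
  (rep_cls (is_path_mulr (x := g') pk)) _.
rewrite -/(Jmap (h, g)) -/(Jmap (k, g')) -/(gpd_src (Jmap (h, g))).
rewrite -/(gpd_rng (Jmap (k, g'))) gpd_src_Jmap gpd_rng_Jmap /= => /(_ gE) m.
apply: homotopic_trans m _; apply: homotopic_eq.
  by apply: is_path_mul; [apply: is_path_mulr|]; exact: is_path_mulr.
by move=> t _; rewrite /= !tg_simp.
Qed.

(** The formula for the reverse gives [g * (h * g)^-1 * p(h) * g], which is [h^-1 * p(h) * g]. *)
Lemma Jmap_inv (x : Htype R TG * G) : Jmap (tg_ginv x) = gpd_inv (Jmap x).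
Proof.
case: x => h g; have ph := rep_is_path (set_val h).
rewrite JmapE /= set_val_H_inv rtranslate_cls; last exact: is_path_inv.
apply/cls_homotopic/homotopic_sym.
apply: homotopic_trans (reverse_homotopic (rep_is_path _)) _.
rewrite -/(gpd_src (Jmap (h, g))) -/(gpd_rng (Jmap (h, g))).
rewrite gpd_src_Jmap gpd_rng_Jmap /=.
have pg : is_path (cst g : R -> G) := @cst_is_path R G g.
have m := homotopic_mul (homotopic_refl pg)
  (homotopic_inv (rep_cls (is_path_mulr (x := g) ph))).
have {}m := homotopic_mulr (tg_rng (h, g)) m.
apply: homotopic_trans m _; apply: homotopic_eq.
  by apply/is_path_mulr/is_path_mul => //; exact/is_path_inv/is_path_mulr.
by move=> t _; rewrite /= /tg_rng tg_invM !tg_simp.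
Qed.

(** * Continuity of the isomorphism and of its inverse *)

Lemma Jmap_continuous : locally_path_connected R G ->
  semilocally_simply_connected R G -> continuous (@Jmap R G TG).
Proof.
move=> lpc slsc x.
apply: (continuous_comp (f := fun x : Htype R TG * G => (set_val x.1, x.2))
  (g := rtranslate)); last exact: rtranslate_continuous.
apply: pair_continuous => {}x; last exact: cvg_snd.
apply: (continuous_comp (f := fst) (g := set_val)); first exact: cvg_fst.
exact: initial_continuous.
Qed.

Lemma Jinv_continuous : locally_path_connected R G ->
  semilocally_simply_connected R G -> continuous Jinv.
Proof.
move=> lpc slsc; have sc := gpd_src_continuous lpc slsc.
(* The topology of [Htype] is initial for the inclusion, so the first component is tested in the
   fundamental groupoid. *)
apply: pair_continuous => //; apply: continuous_comp_initial => c.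
apply: (continuous_comp (f := fun c => (c, V (gpd_src c))) (g := rtranslate)).
  by apply: pair_continuous; [move=> u; exact: cvg_id|exact: continuous_tg_inv].
exact: rtranslate_continuous.
Qed.

End GroupPaths.

Theorem theorem2p13 (R : realType) (G : topologicalType) (TG : topGroup G) :
  locally_path_connected R G ->
  path_connected_set R (@setT G) ->
  semilocally_simply_connected R G ->
  let J := @Jmap R G TG in
  [/\ (* J is a homeomorphism H ⋉_p G -> Pi_1(G) ... *)
      continuous J,
      (exists K : Pi1 R G -> (Htype R TG * G)%type,
          [/\ cancel J K, cancel K J & continuous K]) &
      (* ... and a morphism of groupoids *)
      [/\ (forall x, gpd_src (J x) = tg_src x),
          (forall x, gpd_rng (J x) = tg_rng x),
          (forall x y, tg_composable x y ->
             J (tg_gmul x y) = gpd_mul (J x) (J y)) &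
          (forall x, J (tg_ginv x) = gpd_inv (J x))]].
Proof.
move=> lpc _ slsc J; split; first exact: Jmap_continuous.
  exists (@Jinv R G TG).
  by split; [exact: JmapK|exact: JinvK|exact: Jinv_continuous].
split; [exact: gpd_src_Jmap|exact: gpd_rng_Jmap|exact: Jmap_mul|].
exact: Jmap_inv.
Qed.
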